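(* Let $d\ge 1$ and let $A\in PL_d(\mathbb{C})$. Then the spectral radius of $A$ satisfies $\rho(A)\le 1$.
   Context: A $d\times d$ matrix is a Permutation-Like Matrix (PLM) if all its entries are $0$ or $1$ and each column contains exactly one entry equal to $1$; $PL_d(\mathbb{C})$ is the set of all $d\times d$ PLM regarded as complex matrices. The spectral radius $\rho(A)$ is the maximum of $|\lambda|$ over the complex eigenvalues $\lambda$ of $A$. *)

(* Defs.v *)
From mathcomp Require Import all_boot all_order all_algebra.
From mathcomp Require Import all_classical all_reals.
From mathcomp Require Export complex.

Set Implicit Arguments.
Unset Strict Implicit.
Unset Printing Implicit Defensive.

Import Order.TTheory GRing.Theory Num.Theory.

Local Open Scope classical_set_scope.
Local Open Scope ring_scope.
Local Open Scope complex_scope.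

Definition PL (K : fieldType) (d : nat) : set 'M[K]_d :=
  [set A | (forall i j, A i j = 0 \/ A i j = 1) /\
           (forall j, exists! i, A i j = 1)].

Arguments PL : clear implicits.

(* Since the norm of R[i] takes its values in R[i], the modulus used here is
   the real-valued normc.  For d >= 1 the supremum is a maximum, see
   spectral_radius_max; the spectrum is empty only when d = 0, where
   sup set0 = 0. *)
Definition spectral_radius (R : realType) (d : nat) (A : 'M[R[i]]_d) : R :=
  sup [set Normc.normc l | l in [set l | eigenvalue A l]].

Lemma spectral_radius_max (R : realType) (d : nat) (A : 'M[R[i]]_d) :
  (1 <= d)%N ->
  (exists2 l, eigenvalue A l & Normc.normc l = spectral_radius A) /\
  (forall l, eigenvalue A l -> Normc.normc l <= spectral_radius A).
Proof.
move=> d_gt0; have [s sE] := closed_field_poly_normal (char_poly A).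
have {sE} eigE l : eigenvalue A l = (l \in s).
  rewrite eigenvalue_root_char sE rootZ ?root_prod_XsubC //.
  by rewrite (monicP (char_poly_monic A)) oner_neq0.
have /closed_rootP[l0] : size (char_poly A) != 1%N.
  by rewrite size_char_poly eqSS -lt0n.
rewrite -eigenvalue_root_char eigE => l0s.
have [l ls lmax] : exists2 l, l \in s &
    forall m, m \in s -> Normc.normc m <= Normc.normc l.
  elim: s l0 l0s {eigE} => // a s IHs _ _.
  case: s IHs => [_|b s IHs].
    by exists a => [|m]; rewrite inE // => /eqP->.
  have [l ls lmax] := IHs b (mem_head _ _).
  have [al|la] := leP (Normc.normc a) (Normc.normc l).
    by exists l => [|m]; rewrite in_cons ?ls ?orbT // => /predU1P[->|/lmax].
  exists a => [|m]; rewrite in_cons ?eqxx // => /predU1P[->//|/lmax ml].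
  exact: le_trans ml (ltW la).
have ubl : ubound [set Normc.normc l | l in [set l | eigenvalue A l]]
    (Normc.normc l).
  by move=> _ [m /= + <-]; rewrite eigE => /lmax.
have srE : Normc.normc l = spectral_radius A.
  apply/eqP; rewrite eq_le; apply/andP; split.
    by apply: ub_le_sup; [exists (Normc.normc l) | exists l; rewrite //= eigE].
  by apply: ge_sup => //; exists (Normc.normc l), l; rewrite //= eigE.
split; first by exists l; rewrite ?eigE.
by move=> m; rewrite eigE -srE => /lmax.
Qed.

(* Main.v *)
(* Row eigenvectors fit the column condition: each entry of [v *m A] is an entry
   of [v].  So if [v *m A = l *: v] and [v 0 j] has maximal modulus, then
   [l * v 0 j] is again an entry of [v], whence [|l| |v 0 j| <= |v 0 j|]. *)
Require Import Defs.
From mathcomp Require Import all_boot all_order all_algebra.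
From mathcomp Require Import all_classical all_reals.

Import Order.TTheory GRing.Theory Num.Theory.

Local Open Scope classical_set_scope.
Local Open Scope ring_scope.
Local Open Scope complex_scope.

(** Column [j] of [A] is a standard basis vector, with its 1 in some row [i]. *)
Lemma PL_mul_row (K : fieldType) (d : nat) (A : 'M[K]_d) (v : 'rV[K]_d) j :
  PL K d A -> exists i, (v *m A) 0 j = v 0 i.
Proof.
move=> [A01 /(_ j)[i [Aij1 Auniq]]]; exists i.
rewrite mxE (bigD1 i) //= Aij1 mulr1 big1 ?addr0 // => k neq_ki.
have [->|/Auniq eq_ik] := A01 k j; first by rewrite mulr0.
by rewrite eq_ik eqxx in neq_ki.
Qed.

Lemma PL_eigenvalue_normc (R : rcfType) (d : nat) (A : 'M[R[i]]_d) (l : R[i]) :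
  PL R[i] d A -> eigenvalue A l -> Normc.normc l <= 1.
Proof.
move=> hA /eigenvalueP[v vA /rV0Pn[k vk_neq0]].
(* The nonzero entry [v 0 k] makes the index type inhabited and the maximal modulus positive, so
   that it can be cancelled at the end. *)
case: (arg_maxP (fun i => Normc.normc (v 0 i)) (erefl : predT k)) => j _ vj_max.
have vj_gt0 : 0 < Normc.normc (v 0 j).
  apply: lt_le_trans (vj_max k isT).
  (* The norm of [R[i]] is by definition [normc] embedded in [R[i]]. *)
  by rewrite -ltcR -[(Normc.normc _)%:C]/(`|v 0 k|) normr_gt0.
have [m] := PL_mul_row _ _ _ v j hA; rewrite vA mxE => lvj.
by rewrite -(ler_pM2r vj_gt0) mul1r -Normc.normcM lvj; apply: vj_max.
Qed.

Theorem proposition4p3 (R : realType) (d : nat) (hd : (1 <= d)%N)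
    (A : 'M[R[i]]_d) (hA : PL R[i] d A) :
  spectral_radius A <= 1.
Proof.
(* As [d >= 1], the supremum is the modulus of an eigenvalue [l]. *)
have [[l Al <-] _] := spectral_radius_max A hd.
exact: PL_eigenvalue_normc Al.
Qed.
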